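(* Let $m\ge0$ be an integer, and suppose that $u,u',\dots,u^{(m-1)}$ are absolutely continuous on $[-1,1]$ and that $u^{(m)}$ is of bounded variation, with total variation denoted by $V_L^{(m)}$. Let $n$ be an integer. (i) If $n\ge m+1$ and $n-m$ is odd, then $$|\hat u_n^{C}|\le\frac{2V_L^{(m)}}{\pi}\prod_{j=0}^{m}\frac{1}{n-m+2j}.$$ (ii) If $n\ge m+1$ and $n-m$ is even, then $$|\hat u_n^{C}|\le\frac{2V_L^{(m)}}{\pi\sqrt{n^2-m^2}}\prod_{j=0}^{m-1}\frac{1}{n-m+2j+1}.$$ (iii) If $1\le n\le m+1$, then $$|\hat u_n^{C}|\le\frac{2\,V_L^{(n-1)}}{\pi\,(2n-1)!!}.$$
   Context: Chebyshev coefficients: $\hat u_n^C=\frac{2}{\pi}\int_{-1}^1 u(x)\frac{T_n(x)}{\sqrt{1-x^2}}\,dx$, with $T_n(x)=\cos(n\arccos x)$. $V_L^{(k)}$ denotes the total variation of $u^{(k)}$ on $(-1,1)$, $0\le k\le m$ (so $V_L^{(k)}=\|u^{(k+1)}\|_{L^1(-1,1)}$ when $u^{(k)}$ is absolutely continuous). For $m=0$ there is no absolute continuity assumption. An empty product equals $1$, and $(2n-1)!!=1\cdot3\cdots(2n-1)$. *)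

(* Defs.v *)
From mathcomp Require Import all_boot all_order all_algebra.
From mathcomp Require Import all_classical all_reals all_analysis.
Set Implicit Arguments.
Unset Strict Implicit.
Unset Printing Implicit Defensive.
Import Order.TTheory GRing.Theory Num.Theory.
Import numFieldNormedType.Exports.
Local Open Scope classical_set_scope.
Local Open Scope ring_scope.

Definition chebyshevT (R : realType) (n : nat) (x : R) : R :=
  cos (n%:R * acos x).

Definition chebyshev_coef (R : realType) (u : R -> R) (n : nat) : R :=
  2 / pi * \int[lebesgue_measure]_(x in `]-1, 1[)
             (u x * chebyshevT n x / Num.sqrt (1 - x ^+ 2)).

Definition absolutely_continuous_on (R : realType) (a b : R) (f : R -> R) :
    Prop :=
  forall e : R, 0 < e -> exists2 d : R, 0 < d &
    forall (N : nat) (s t : 'I_N -> R),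
      (forall i, a <= s i /\ s i <= t i /\ t i <= b) ->
      trivIset [set: 'I_N] (fun i => `]s i, t i[%classic) ->
      \sum_i (t i - s i) < d -> \sum_i `|f (t i) - f (s i)| < e.

(* [total_variation] is over a closed interval. Over the open interval ]a, b[
   the values of [f] at [a] and [b] must not count. *)
Definition total_variation_oo (R : realType) (a b : R) (f : R -> R) : \bar R :=
  ereal_sup [set V | exists c d : R,
    [/\ a < c, c <= d, d < b & V = total_variation c d f]].

(* [v k] stands for the k-th derivative of [u] on [-1, 1], for k <= m. For
   k < m the function [v k] is meant to be absolutely continuous on [-1, 1], so
   [v 1], ..., [v m.-1] are derivatives at every point of ]-1, 1[; their values
   at -1 and 1 (one-sided derivatives) are then forced by continuity. The
   derivative of [v m.-1] need only exist almost everywhere: [v m] is any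
   representative of it. If m = 0 then [v m] is [u] itself. *)
Definition derivatives_upto (R : realType) (m : nat) (u : R -> R)
    (v : nat -> R -> R) : Prop :=
  [/\ forall x : R, -1 <= x <= 1 -> v 0%N x = u x,
      forall k, (k.+1 < m)%N -> forall x : R, -1 < x < 1 ->
        is_derive x (1 : R) (v k) (v k.+1 x) &
      (0 < m)%N -> {ae @lebesgue_measure R, forall x : R, -1 < x < 1 ->
        is_derive x (1 : R) (v m.-1) (v m x)}].

Definition odd_double_factorial (n : nat) : nat := (\prod_(j < n) (2 * j + 1))%N.

(* Main.v *)
Require Import Defs.
From mathcomp Require Import all_boot all_order all_algebra.
From mathcomp Require Import all_classical all_reals all_analysis.
From mathcomp Require Import measurable_realfun zify ring lra.
Import Order.TTheory GRing.Theory Num.Theory.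
Import numFieldNormedType.Exports.
Local Open Scope classical_set_scope.
Local Open Scope ring_scope.

(** Let n > m.  Put K_0(x) = T_n(x) / sqrt (1 - x^2), so that the n-th coefficient is
    2 / pi times the integral of u K_0, and integrate by parts m + 1 times.
    The successive kernels K_1, ..., K_(m+1), with K_(k+1)' = - K_k, have a
    closed description: K_1(x) = sin (n arccos x) / n, and
<<
      (n^2 - k^2) K_(k+1) = (2k - 1) x K_k - (1 - x^2) K_(k-1).
>>
    (Up to a constant K_(k+1) is (1 - x^2)^(k+1/2) times the Gegenbauer
    polynomial of degree n - k - 1 and parameter k + 1.)  They are O(sqrt (1 -
    x^2)) at the endpoints for k >= 1, so no boundary term survives, and what
    remains is the Stieltjes integral of K_(m+1) against the derivative of
    order m of u.  Hence the coefficient is at most 2 / pi times sup |K_(m+1)|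
    times the total variation ([chebyshev_coef_le]).

    The supremum comes from Sonine's function ([sonine_bound])
<<
      E = K_(m+1)^2 + (1 - x^2) K_m^2 / (n^2 - m^2),
      E' = - 4 m x K_m^2 / (n^2 - m^2),
>>
    which is largest at x = 0.  Of the two numbers K_(m+1)(0) and K_m(0) one
    vanishes, by parity, and the other is an explicit product
    ([cheb_kernel_at0]); which one vanishes separates cases (i) and (ii).
    Case (iii) is case (i) for the order n - 1.

    All the integrations by parts are done at once, on the function
<<
      H(x) = int_(-1)^x u K_0 + sum_(k < m) v_k K_(k+1).
>>
    The sum of its derivative telescopes, so that H' = - v_m K_(m+1)' almost
    everywhere on ]-1, 1[, and H is absolutely continuous on every compact
    subinterval.  These two facts alone bound the increment of H + v_m K_(m+1)
    by sup |K_(m+1)| times the variation of v_m ([stieltjes_bound]); the proof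
    chops the interval into pieces that either contain a point where the
    derivative is right or lie in a small open set, on which absolute
    continuity takes over.  Finally [-d, d] grows to ]-1, 1[. *)

(** * Absolute continuity *)

(** The supremum of the points y with P a y is reached and cannot be interior,
    as its own neighbourhood would push it further.  This is compactness of
    [a, b] in the form of Cousin's lemma: every gauge has a fine tagged
    partition. *)
Lemma cousin_induction {R : realType} (P : R -> R -> Prop) (a b : R) :
  a <= b ->
  (forall s x t, a <= s -> s <= x -> x <= t -> t <= b ->
    P s x -> P x t -> P s t) ->
  (forall x, a <= x <= b -> exists2 r, 0 < r &
    forall s t, a <= s -> s <= x -> x <= t -> t <= b ->
      x - r < s -> t < x + r -> P s t) ->
  P a b.
Proof.
move=> ab Ptrans Ploc.
pose A := [set y | a <= y <= b /\ P a y].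
have [ra ra0 Pa] := Ploc a ltac:(by rewrite lexx ab).
have Aa : A a.
  by split; [rewrite lexx ab|apply: Pa => //; lra].
have supA : has_sup A.
  by split; [exists a|exists b => y [/andP[]]].
set z := sup A.
have az : a <= z by apply: ub_le_sup => //; case: supA.
have zb : z <= b by apply: ge_sup; [exists a|move=> y [/andP[]]].
have [r r0 Pz] := Ploc z ltac:(by rewrite az zb).
have [y [/andP[ay yb] Pay] yz] := sup_adherent r0 supA.
have {}yz' : y <= z by apply: ub_le_sup => //; [case: supA|split=> //; rewrite ay].
have Pat t : z <= t -> t <= b -> t < z + r -> P a t.
  move=> zt tb tr; apply: (Ptrans a y t) => //; first exact: le_trans zt.
  exact: Pz.
have [zb'|zb'] := ltP z b; last by apply: Pat => //; lra.
pose t := Num.min b (z + r / 2).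
have tb : t <= b by rewrite ge_min lexx.
have zt : z < t by rewrite lt_min zb'/=; lra.
have : A t.
  split; first by rewrite tb (le_trans az (ltW zt)).
  apply: Pat => //; first exact: ltW.
  by rewrite gt_min; apply/orP; right; lra.
by move=> /(ub_le_sup (proj2 supA)); rewrite leNgt zt.
Qed.

(** Finite families of non-overlapping intervals, listed from left to right so
    that families over adjacent intervals can be concatenated. *)
Definition separated_in {R : realType} (a b : R) (L : seq (R * R)) : bool :=
  pairwise (fun p q => p.2 <= q.1) L &&
  all (fun p => [&& a <= p.1, p.1 <= p.2 & p.2 <= b]) L.

Lemma separated_in_cat {R : realType} (a x b : R) (L L' : seq (R * R)) :
  a <= x -> x <= b ->
  separated_in a x L -> separated_in x b L' -> separated_in a b (L ++ L').
Proof.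
move=> ax xb /andP[pL /allP aL] /andP[pL' /allP aL'].
rewrite /separated_in pairwise_cat pL pL' !andbT all_cat; apply/and3P; split.
- apply/allrelP => p q /aL /and3P[_ _ px] /aL' /and3P[xq _ _].
  exact: le_trans xq.
- by apply/allP => p /aL /and3P[-> -> px]/=; exact: le_trans xb.
- by apply/allP => p /aL' /and3P[xp -> ->]/=; rewrite andbT; exact: le_trans xp.
Qed.

Lemma absolutely_continuous_seq {R : realType} (a b : R) (f : R -> R) :
  absolutely_continuous_on a b f ->
  forall e, 0 < e -> exists2 d, 0 < d & forall L, separated_in a b L ->
    \sum_(p <- L) (p.2 - p.1) < d -> \sum_(p <- L) `|f p.2 - f p.1| < e.
Proof.
move=> acf e /acf[d d0 Hd]; exists d => // L /andP[pL /allP aL] sL.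
pose s (i : 'I_(size L)) := (nth (0, 0) L i).1.
pose t (i : 'I_(size L)) := (nth (0, 0) L i).2.
have := Hd _ s t; rewrite (big_nth (0, 0)) big_mkord; apply.
- by move=> i; have /aL/and3P[] := mem_nth (0, 0) (ltn_ord i).
- apply/trivIsetP => i j _ _; wlog ij : i j / (i < j)%N.
    move=> H; rewrite neq_ltn => /orP[ij|ji]; last rewrite setIC; apply: H => //.
      by rewrite neq_ltn ij.
    by rewrite neq_ltn ji.
  move=> _; apply/seteqP; split => // x [] /=; rewrite !in_itv/=.
  move=> /andP[_ xt] /andP[sx _].
  have /(pairwiseP (0, 0))/(_ i j (ltn_ord i) (ltn_ord j) ij) := pL.
  rewrite -/(t i) -/(s j) => H.
  by have := lt_le_trans (lt_trans sx xt) H; rewrite ltxx.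
- by move: sL; rewrite (big_nth (0, 0)) big_mkord.
Qed.

Lemma absolutely_continuous_sub {R : realType} (a b c d : R) (f : R -> R) :
  a <= c -> d <= b ->
  absolutely_continuous_on a b f -> absolutely_continuous_on c d f.
Proof.
move=> ac db acf e /acf[r r0 Hr]; exists r => // N s t st; apply: Hr => i.
by have [? []] := st i; split; [lra|split; lra].
Qed.

Lemma absolutely_continuousD {R : realType} (a b : R) (f g : R -> R) :
  absolutely_continuous_on a b f -> absolutely_continuous_on a b g ->
  absolutely_continuous_on a b (fun x => f x + g x).
Proof.
move=> acf acg e e0.
have [r r0 Hr] := acf _ (divr_gt0 e0 (ltr0Sn R 1)).
have [q q0 Hq] := acg _ (divr_gt0 e0 (ltr0Sn R 1)).
exists (Num.min r q); first by rewrite lt_min r0.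
move=> N s t st tr; rewrite lt_min => /andP[/(Hr _ _ _ st tr) h1 /(Hq _ _ _ st tr) h2].
rewrite (splitr e); apply: le_lt_trans (ltrD h1 h2); rewrite -big_split/=; apply: ler_sum => i _.
by rewrite opprD addrACA; exact: ler_normD.
Qed.

Lemma absolutely_continuousM {R : realType} (a b B : R) (f g : R -> R) :
  (forall x, a <= x <= b -> `|f x| <= B) ->
  (forall x, a <= x <= b -> `|g x| <= B) ->
  absolutely_continuous_on a b f -> absolutely_continuous_on a b g ->
  absolutely_continuous_on a b (fun x => f x * g x).
Proof.
move=> fB gB acf acg e e0.
pose C := `|B| + 1.
have C0 : 0 < C by rewrite /C; have := normr_ge0 B; lra.
have BC : B <= C by rewrite /C; have := ler_norm B; lra.
have e'0 : 0 < e / C / 2 by rewrite !divr_gt0.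
have [r r0 Hr] := acf _ e'0.
have [q q0 Hq] := acg _ e'0.
exists (Num.min r q); first by rewrite lt_min r0.
move=> N s t st tr; rewrite lt_min => /andP[/(Hr _ _ _ st tr) h1 /(Hq _ _ _ st tr) h2].
have -> : e = C * (e / C / 2 + e / C / 2) by field; rewrite gt_eqF.
apply: (@le_lt_trans _ _ (C * (\sum_i `|f (t i) - f (s i)| + \sum_i `|g (t i) - g (s i)|))).
  rewrite -big_split/= mulr_sumr; apply: ler_sum => i _.
  have [asi [sti tib]] := st i.
  have -> : f (t i) * g (t i) - f (s i) * g (s i) =
    (f (t i) - f (s i)) * g (t i) + f (s i) * (g (t i) - g (s i)) by ring.
  rewrite [leRHS]mulrDr (le_trans (ler_normD _ _))// !normrM lerD//.
    by rewrite mulrC ler_wpM2r// (le_trans _ BC)// gB// tib andbT; lra.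
  by rewrite ler_wpM2r// (le_trans _ BC)// fB// asi/=; lra.
by rewrite ltr_pM2l// ltrD.
Qed.

Lemma lipschitz_absolutely_continuous {R : realType} (a b C : R) (f : R -> R) :
  (forall x y, a <= x -> x <= y -> y <= b -> `|f y - f x| <= C * (y - x)) ->
  absolutely_continuous_on a b f.
Proof.
move=> fC e e0; pose D := `|C| + 1.
have D0 : 0 < D by rewrite /D; have := normr_ge0 C; lra.
have CD : C <= D by rewrite /D; have := ler_norm C; lra.
exists (e / D); first by rewrite divr_gt0.
move=> N s t st _ se; have -> : e = D * (e / D) by field; rewrite gt_eqF.
apply: (@le_lt_trans _ _ (D * (\sum_i (t i - s i)))); last by rewrite ltr_pM2l.
rewrite mulr_sumr; apply: ler_sum => i _; have [asi [sti tib]] := st i.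
by apply: le_trans (fC _ _ asi sti tib) _; rewrite ler_wpM2r// subr_ge0.
Qed.

Lemma absolutely_continuous_bigsum {R : realType} (a b : R) (m : nat) (h : nat -> R -> R) :
  (forall k, (k < m)%N -> absolutely_continuous_on a b (h k)) ->
  absolutely_continuous_on a b (fun y => \sum_(0 <= k < m) h k y).
Proof.
elim: m => [|m IH] hh.
  apply: (@lipschitz_absolutely_continuous _ _ _ 0) => x y _ _ _.
  by rewrite !big_nil subrr normr0 mul0r.
have -> : (fun y => \sum_(0 <= k < m.+1) h k y) =
    (fun y => \sum_(0 <= k < m) h k y + h m y).
  by apply/funext => y; rewrite big_nat_recr.
by apply: absolutely_continuousD; [apply: IH => k km; apply: hh; exact: ltnW|exact: hh].
Qed.

Lemma absolutely_continuous_modulus {R : realType} (a b : R) (f : R -> R) :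
  absolutely_continuous_on a b f -> forall e, 0 < e -> exists2 d, 0 < d &
    forall x y, a <= x <= b -> a <= y <= b -> `|y - x| < d -> `|f y - f x| < e.
Proof.
move=> acf e e0; have [d d0 Hd] := absolutely_continuous_seq _ _ _ acf _ e0.
exists d => // x y; wlog xy : x y / x <= y.
  move=> H xab yab; have [xy|/ltW yx] := leP x y; first exact: H.
  by rewrite (distrC y) (distrC (f y)); exact: H.
move=> /andP[ax _] /andP[_ yb]; rewrite ger0_norm ?subr_ge0// => yxd.
have := Hd [:: (x, y)]; rewrite !big_seq1/=; apply => //.
by rewrite /separated_in/= ax xy yb.
Qed.

Lemma absolutely_continuous_bounded {R : realType} (a b : R) (f : R -> R) :
  absolutely_continuous_on a b f ->
  exists B, forall x, a <= x <= b -> `|f x| <= B.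
Proof.
move=> acf; have [ab|ba] := leP a b; last by exists 0 => x /andP[ax xb]; lra.
have [d d0 Hd] := absolutely_continuous_modulus _ _ _ acf _ ltr01.
pose P s t := exists B, forall x, s <= x <= t -> `|f x| <= B.
apply: (@cousin_induction _ P) => // [s y t _ _ _ _ [B HB] [C HC]|x xab].
  exists (Num.max B C) => x /andP[sx xt]; rewrite le_max.
  have [xy|/ltW yx] := leP x y; first by rewrite HB ?sx.
  by rewrite (HC x) ?orbT// yx.
exists d => // s t as_ sx xt tb xds txd; exists (`|f x| + 1) => y /andP[sy yt].
have yab : a <= y <= b by rewrite (le_trans as_)// (le_trans yt).
have := Hd _ _ xab yab; rewrite ltr_distl => /(_ _)/ltW H.
rewrite -[f y](subrK (f x)) addrC (le_trans (ler_normD _ _))// lerD2l H//.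
by apply/andP; split; lra.
Qed.

Lemma absolutely_continuous_continuous {R : realType} (a b : R) (f : R -> R) x :
  absolutely_continuous_on a b f -> a < x < b -> {for x, continuous f}.
Proof.
move=> acf /andP[ax xb]; apply/cvgrPdist_lt => e e0.
have [d d0 Hd] := absolutely_continuous_modulus _ _ _ acf _ e0.
pose r := Num.min d (Num.min (x - a) (b - x)).
have r0 : 0 < r by rewrite !lt_min d0 !subr_gt0 ax.
near=> y; have : `|x - y| < r by near: y; exact: (@nbhsx_ballx R R^o x r r0).
rewrite !lt_min => /and3P[xyd h h'].
apply: Hd => //; move: h h'; rewrite !ltr_distl => /andP[? ?] /andP[? ?];
  by apply/andP; split; lra.
Unshelve. all: by end_near. Qed.

(** * A mean value bound of Stieltjes type *)

(** With U an open set of measure less than e that contains N, l x is the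
    measure of the part of U between c and x.  The function l bounds the total
    length of non-overlapping intervals contained in U, in an additive form. *)
Lemma negligible_gauge {R : realType} (c d e : R) (N : set R) :
  (@lebesgue_measure R).-negligible N -> 0 < e ->
  exists l : R -> R, [/\ {homo l : x y / x <= y}, l d - l c < e &
    forall x, N x -> exists2 r, 0 < r & forall s t,
      c <= s -> s <= x -> x <= t -> x - r < s -> t < x + r ->
      t - s <= l t - l s].
Proof.
move=> [A' [mA' muA' NA']] e0.
have [A [mA muA NA]] : exists A : set R,
  [/\ measurable A, (@lebesgue_measure R A = 0)%E & N `<=` A] by exists A'.
have leM (B C : set R) : measurable B -> measurable C -> B `<=` C ->
  (@lebesgue_measure R B <= @lebesgue_measure R C)%E.
  by move=> mB mC BC; apply: le_measure; rewrite ?inE.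
have [U [oU AU Ue]] : exists U : set R, [/\ open U, A `<=` U &
    (lebesgue_measure (U `\` A) < e%:E)%E].
  apply: lebesgue_regularity_outer => //.
  by rewrite [X in (X < _)%E](_ : _ = 0%E)// ltry.
have mU : measurable U by exact: open_measurable.
have {}Ue : (@lebesgue_measure R U < e%:E)%E.
  apply: le_lt_trans Ue; rewrite -[leRHS]adde0.
  rewrite -[X in (_ <= _ + X)%E](_ : lebesgue_measure A = _)//.
  apply: le_trans (measureU2 _ _ _) => //; last exact: measurableD.
  apply: leM => //.
    by apply: measurableU => //; exact: measurableD.
  by move=> x Ux; have [Ax|Ax] := pselect (A x); [right|left].
pose m x := (@lebesgue_measure R (U `&` `]c, x])).
have mm x : measurable (U `&` `]c, x]) by exact: measurableI.
have mfin x : m x \is a fin_num.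
  rewrite ge0_fin_numE ?measure_ge0//; apply: le_lt_trans (ltry e).
  by apply: le_trans (ltW Ue); apply: leM => //; exact: subIsetl.
exists (fine \o m); split => /=.
- move=> x y xy; apply: fine_le => //; apply: leM => //.
  by apply: setIS => z /=; rewrite !in_itv/= => /andP[-> /le_trans]; exact.
- have -> : m c = 0%E.
    by rewrite /m set_itvoc0 ?setI0 ?measure0.
  rewrite subr0 -lte_fin fineK//; apply: le_lt_trans Ue.
  by apply: leM => //; exact: subIsetl.
- move=> x /NA /AU Ux.
  have [r /= r0 xrU] : nbhs x U by exact: open_nbhs_nbhs.
  exists r => // s t cs sx xt xrs txr.
  rewrite lerBrDr -lee_fin EFinD !fineK//.
  have -> : (t - s)%:E = (@lebesgue_measure R `]s, t]%classic).
    rewrite lebesgue_measure_itv/= lte_fin; case: ltP => // ts.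
    by have -> : t = s; [lra|rewrite subrr].
  have <- : @lebesgue_measure R (`]s, t] `|` U `&` `]c, s])%classic =
      (@lebesgue_measure R `]s, t]%classic + m s)%E.
    apply: measureU => //; first exact: mm.
    apply/seteqP; split => // y [/=]; rewrite in_itv/= => /andP[sy _] [_].
    by rewrite in_itv/= => /andP[_]; rewrite leNgt sy.
  apply: (leM _ (U `&` `]c, t])) => //; first exact: measurableU.
  move=> y [|[Uy]]; rewrite /= in_itv/= => /andP[sy yt]; last first.
    by split => //=; rewrite in_itv/= sy; lra.
  split; last by rewrite /= in_itv/= yt andbT; lra.
  by apply: xrU; rewrite /= distrC ltr_distl; apply/andP; split; lra.
Qed.

Lemma is_derive_approx {R : realType} (f : R -> R) (x l : R) :
  is_derive x (1 : R) f l -> forall e, 0 < e -> exists2 r, 0 < r &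
    forall y, `|y - x| < r -> `|f y - f x - l * (y - x)| <= e * `|y - x|.
Proof.
move=> [df fl] e e0; have := df; rewrite /derivable => /cvg_ex [l' Hl'].
have ll' : l' = l by rewrite -fl; apply/esym/cvg_lim.
move: Hl'; rewrite ll' => /cvgrPdist_le /(_ e e0) [r /= r0 Hr].
exists r => // y yxr; have [->|yx] := eqVneq y x.
  by rewrite !subrr mulr0 subr0 normr0 mulr0.
have yx0 : y - x != 0 by rewrite subr_eq0.
have := Hr (y - x); rewrite /= sub0r normrN => /(_ yxr yx0).
have -> : (y - x) *: (1 : R) + x = y by rewrite scaler1 subrK.
rewrite -(ler_pM2r (_ : 0 < `|y - x|)) ?normr_gt0//.
rewrite (distrC l) -normrM /GRing.scale/=; congr (`|_| <= _).
by field.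
Qed.

(** Write Phi = H + g F.  When s <= x <= t, the increment of Phi over [s, t]
    differs from that of H + g(x) F (g frozen at the tag x) by
    (g t - g x) F t + (g x - g s) F s, at most M (V t - V s).  The frozen
    increment is o(t - s) if the derivative exists at x and vanishes; the
    other tags form a null set, and there the intervals are collected in a
    list of small total length, on which H and F vary little by absolute
    continuity.  All the terms of the estimate are additive in [s, t], so
    Cousin's lemma applies. *)
Lemma stieltjes_bound {R : realType} (c d M : R) (H F g V : R -> R) :
  c <= d ->
  absolutely_continuous_on c d H -> absolutely_continuous_on c d F ->
  (forall x, c <= x <= d -> `|F x| <= M) ->
  (forall x y, c <= x -> x <= y -> y <= d -> `|g y - g x| <= V y - V x) ->
  {ae @lebesgue_measure R, forall x, c <= x <= d ->
    is_derive x (1 : R) (fun y => H y + g x * F y) 0} ->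
  `|(H d + g d * F d) - (H c + g c * F c)| <= M * (V d - V c).
Proof.
move=> cd acH acF FM gV HF.
have M0 : 0 <= M by apply: le_trans (FM c _); rewrite ?lexx.
(* B bounds |g|; the summand 1 makes it positive. *)
pose B := `|g c| + (V d - V c) + 1.
have B0 : 0 < B.
  have := gV _ _ (lexx c) cd (lexx d); have := normr_ge0 (g d - g c).
  by have := normr_ge0 (g c); rewrite /B; lra.
have gB x : c <= x -> x <= d -> `|g x| <= B.
  move=> cx xd; have := gV _ _ (lexx c) cx xd; have := gV _ _ cx xd (lexx d).
  have := normr_ge0 (g d - g x); have := ler_normB (g c) (g c - g x).
  by rewrite (_ : g c - (g c - g x) = g x) 1?distrC /B; [lra|ring].
pose Phi x := H x + g x * F x.
(* The error made by freezing g at the tag x. *)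
have PhiE s x t : c <= s -> s <= x -> x <= t -> t <= d ->
    `|Phi t - Phi s| <= M * (V t - V s) + `|(H t + g x * F t) - (H s + g x * F s)|.
  move=> cs sx xt td.
  have -> : Phi t - Phi s = ((g t - g x) * F t + (g x - g s) * F s) +
    ((H t + g x * F t) - (H s + g x * F s)) by rewrite /Phi; ring.
  apply: le_trans (ler_normD _ _) _; rewrite lerD2r.
  apply: le_trans (ler_normD _ _) _; rewrite !normrM.
  have -> : M * (V t - V s) = (V t - V x) * M + (V x - V s) * M by ring.
  by rewrite lerD// ler_pM// ?gV// ?FM//; lra.
apply/ler_addgt0Pr => e e0.
pose e1 := e / 2 / (d - c + 1).
have e10 : 0 < e1 by rewrite !divr_gt0//; lra.
have e1E : e1 * (d - c) <= e / 2.
  rewrite /e1 mulrAC ler_pdivrMr; last by lra.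
  by rewrite ler_wpM2l; lra.
have e20 : 0 < e / 4 by rewrite divr_gt0.
have e30 : 0 < e / 4 / B by rewrite !divr_gt0.
have [d1 d10 Hd1] := absolutely_continuous_seq _ _ _ acH _ e20.
have [d2 d20 Hd2] := absolutely_continuous_seq _ _ _ acF _ e30.
have d0 : 0 < Num.min d1 d2 by rewrite lt_min d10.
have [l [l_nd ld lN]] := negligible_gauge c d _ _ HF d0.
pose P s t := exists L, [/\ separated_in s t L,
  \sum_(p <- L) (p.2 - p.1) <= l t - l s &
  `|Phi t - Phi s| <= M * (V t - V s) + e1 * (t - s) +
    (\sum_(p <- L) `|H p.2 - H p.1| + B * \sum_(p <- L) `|F p.2 - F p.1|)].
(* L lists the intervals whose tag is bad. *)
suff [L [sL lL HL]] : P c d.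
  have := le_lt_trans lL ld; rewrite lt_min => /andP[/(Hd1 _ sL) h1 /(Hd2 _ sL) h2].
  apply: le_trans HL _; rewrite -addrA lerD2l.
  have : B * (\sum_(p <- L) `|F p.2 - F p.1|) <= B * (e / 4 / B).
    by rewrite ler_pM2l// ltW.
  have -> : B * (e / 4 / B) = e / 4 by field; rewrite gt_eqF.
  lra.
apply: cousin_induction => //.
  move=> s x t cs sx xt td [L [sL lL HL]] [L' [sL' lL' HL']].
  exists (L ++ L'); rewrite !big_cat/=; split; first exact: separated_in_cat sL'.
    lra.
  have -> : Phi t - Phi s = (Phi x - Phi s) + (Phi t - Phi x) by ring.
  by apply: le_trans (ler_normD _ _) _; lra.
move=> x cxd; have /andP[cx xd] := cxd.
have [dx|ndx] := pselect (is_derive x (1 : R) (fun y => H y + g x * F y) 0).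
  have [r r0 Hr] := is_derive_approx _ _ _ dx _ e10; exists r => // s t cs sx xt td xrs txr.
  exists [::]; rewrite !big_nil mulr0 !addr0; split => //.
    by rewrite subr_ge0 l_nd// (le_trans sx).
  apply: le_trans (PhiE s x t _ _ _ _) _ => //; rewrite lerD2l.
  have := Hr t; rewrite ger0_norm ?subr_ge0// mul0r subr0 => Ht.
  have := Hr s; rewrite ler0_norm ?subr_le0// mul0r subr0 => Hs.
  have {}Ht := Ht ltac:(lra). have {}Hs := Hs ltac:(lra).
  rewrite distrC in Hs.
  have -> : H t + g x * F t - (H s + g x * F s) = (H t + g x * F t - (H x + g x * F x)) +
    (H x + g x * F x - (H s + g x * F s)) by ring.
  by apply: le_trans (ler_normD _ _) _; lra.
have [|r r0 Hr] := lN x; first by move=> /(_ cxd).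
exists r => // s t cs sx xt td xrs txr; exists [:: (s, t)].
rewrite !big_seq1/=; split.
- by rewrite /separated_in/= !lexx andbT (le_trans sx).
- exact: Hr.
- apply: le_trans (PhiE s x t _ _ _ _) _ => //; rewrite -[leRHS]addrA lerD2l.
  have -> : H t + g x * F t - (H s + g x * F s) = (H t - H s) + g x * (F t - F s) by ring.
  apply: le_trans (ler_normD _ _) _; rewrite normrM.
  have := gB _ cx xd; have := normr_ge0 (F t - F s) => F0 gB'.
  have : `|g x| * `|F t - F s| <= B * `|F t - F s| by rewrite ler_wpM2r.
  have : 0 <= e1 * (t - s) by rewrite mulr_ge0; lra.
  lra.
Qed.

(** * Iterated primitives of the Chebyshev weight *)

Lemma is_derive_mul {R : realType} (f g : R -> R) (x a b : R) :
  is_derive x (1 : R) f a -> is_derive x (1 : R) g b ->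
  is_derive x (1 : R) (fun y => f y * g y) (a * g x + f x * b).
Proof.
move=> fa gb; apply: is_derive_eq (is_deriveM fa gb) _.
by rewrite /GRing.scale/=; ring.
Qed.

Lemma is_derive_add {R : realType} (f g : R -> R) (x a b : R) :
  is_derive x (1 : R) f a -> is_derive x (1 : R) g b ->
  is_derive x (1 : R) (fun y => f y + g y) (a + b).
Proof. by move=> fa gb; exact: is_deriveD. Qed.

Lemma is_derive_bigsum {R : realType} (m : nat) (h : nat -> R -> R) (dh : nat -> R) (x : R) :
  (forall k, (k < m)%N -> is_derive x (1 : R) (h k) (dh k)) ->
  is_derive x (1 : R) (fun y => \sum_(0 <= k < m) h k y) (\sum_(0 <= k < m) dh k).
Proof.
elim: m => [|m IH] hh.
  rewrite big_nil; have -> : (fun y => \sum_(0 <= k < 0) h k y) = cst 0.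
    by apply/funext => y; rewrite big_nil.
  exact: is_derive_cst.
rewrite big_nat_recr//=.
have -> : (fun y => \sum_(0 <= k < m.+1) h k y) =
    (fun y => \sum_(0 <= k < m) h k y + h m y).
  by apply/funext => y; rewrite big_nat_recr.
by apply: is_derive_add; [apply: IH => k km; apply: hh; exact: ltnW|exact: hh].
Qed.

Lemma onem_sqr_gt0 {R : realType} (x : R) : -1 < x < 1 -> 0 < 1 - x ^+ 2.
Proof. by move=> /andP[x1 x2]; nra. Qed.

Lemma is_derive_onem_sqr {R : realType} (x : R) :
  is_derive x (1 : R) (fun y => 1 - y ^+ 2) (- (2 * x)).
Proof.
have h : is_derive x (1 : R) (fun y : R => y * y) (1 * x + x * 1).
  by apply: is_derive_mul.
have := is_deriveB (is_derive_cst (1 : R) x (1 : R)) h.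
by move=> H; apply: is_derive_eq H _; ring.
Qed.

Lemma subr_sqr_gt0 {R : realType} (k n : nat) :
  (k < n)%N -> 0 < n%:R ^+ 2 - k%:R ^+ 2 :> R.
Proof. by move=> kn; rewrite subr_gt0 -!natrX ltr_nat ltn_exp2r. Qed.

(** The iterated primitives K_k of T_n / sqrt (1 - x^2).  Only the indices
    k <= n are meaningful: beyond them the denominator may vanish. *)
Fixpoint cheb_kernel {R : realType} (n k : nat) (x : R) : R :=
  match k with
  | 0 => chebyshevT n x / Num.sqrt (1 - x ^+ 2)
  | k1.+1 => match k1 with
    | 0 => sin (n%:R * acos x) / n%:R
    | k2.+1 => ((2 * k2%:R + 1) * x * cheb_kernel n k1 x
                 - (1 - x ^+ 2) * cheb_kernel n k2 x)
               / (n%:R ^+ 2 - k1%:R ^+ 2)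
    end
  end.

Lemma cheb_kernelSS {R : realType} (n k : nat) (x : R) : (k.+1 < n)%N ->
  (n%:R ^+ 2 - k.+1%:R ^+ 2) * cheb_kernel n k.+2 x =
  (2 * k%:R + 1) * x * cheb_kernel n k.+1 x - (1 - x ^+ 2) * cheb_kernel n k x.
Proof.
move=> kn; have h : n%:R ^+ 2 - k.+1%:R ^+ 2 != 0 :> R.
  by rewrite gt_eqF// subr_sqr_gt0.
by rewrite mulrC [cheb_kernel n k.+2 x]/= mulfVK.
Qed.

Section chebyshev_derivatives.
Context {R : realType} (n : nat) (x : R) (n0 : (0 < n)%N) (x1 : -1 < x < 1).
Let r := Num.sqrt (1 - x ^+ 2).
Let r0 : 0 < r. Proof. by rewrite sqrtr_gt0 onem_sqr_gt0. Qed.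
Let r2 : r ^+ 2 = 1 - x ^+ 2.
Proof. by rewrite sqr_sqrtr// ltW// onem_sqr_gt0. Qed.

Lemma is_derive_mulacos : is_derive x (1 : R) (fun y => n%:R * acos y) (- (n%:R / r)).
Proof.
have := is_derive_mul _ _ _ _ _ (is_derive_cst (n%:R : R) x (1 : R)) (is_derive1_acos x1).
by move=> H; apply: is_derive_eq H _; rewrite -/r; ring.
Qed.

Lemma is_derive_chebyshevT :
  is_derive x (1 : R) (chebyshevT n) (n%:R * sin (n%:R * acos x) / r).
Proof.
have := @is_derive1_comp R cos (fun y => n%:R * acos y) _ _ _
  (is_derive_cos _) is_derive_mulacos.
by move=> H; apply: is_derive_eq H _; ring.
Qed.

Lemma is_derive_cheb_kernel1 :
  is_derive x (1 : R) (cheb_kernel n 1) (- cheb_kernel n 0 x).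
Proof.
have := is_derive_mul _ _ _ _ _ 
  (@is_derive1_comp R sin (fun y => n%:R * acos y) _ _ _
    (is_derive_sin _) is_derive_mulacos)
  (is_derive_cst (n%:R^-1 : R) x (1 : R)).
move=> H; apply: is_derive_eq H _; rewrite /= /chebyshevT -/r.
by field; rewrite gt_eqF//= pnatr_eq0 -lt0n.
Qed.

Lemma is_derive_arcsine_weight :
  is_derive x (1 : R) (fun y => (Num.sqrt (1 - y ^+ 2))^-1) (x / r ^+ 3).
Proof.
have ds := @is_derive1_comp R Num.sqrt (fun y => 1 - y ^+ 2) _ _ _
  (is_derive1_sqrt (onem_sqr_gt0 _ x1)) (is_derive_onem_sqr x).
have rn0 : r != 0 by rewrite gt_eqF.
apply: is_derive_eq
  (@is_deriveV R (Num.sqrt \o (fun y => 1 - y ^+ 2)) _ _ _ rn0 ds) _.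
by rewrite /GRing.scale/= -/r; field.
Qed.

Lemma is_derive_cheb_kernel0 : is_derive x (1 : R) (cheb_kernel n 0)
  ((n%:R ^+ 2 * cheb_kernel n 1 x + x * cheb_kernel n 0 x) / (1 - x ^+ 2)).
Proof.
have := is_derive_mul _ _ _ _ _ is_derive_chebyshevT is_derive_arcsine_weight.
move=> H; apply: is_derive_eq H _; rewrite /GRing.scale/= /chebyshevT -/r -r2.
by field; rewrite gt_eqF//= pnatr_eq0 -lt0n.
Qed.

End chebyshev_derivatives.

(** The two formulas support each other: the first one at k, together with the
    second one at k, differentiates the recurrence that defines K_(k+2), while
    the first one at k + 1 is that recurrence read backwards. *)
Lemma is_derive_cheb_kernel {R : realType} (n k : nat) (x : R) :
  (k < n)%N -> -1 < x < 1 ->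
  is_derive x (1 : R) (cheb_kernel n k)
    (((n%:R ^+ 2 - k%:R ^+ 2) * cheb_kernel n k.+1 x
       - (2 * k%:R - 1) * x * cheb_kernel n k x) / (1 - x ^+ 2)) /\
  is_derive x (1 : R) (cheb_kernel n k.+1) (- cheb_kernel n k x).
Proof.
elim: k => [|k IH] kn x1; have n0 : (0 < n)%N by exact: leq_ltn_trans kn.
  split; last exact: is_derive_cheb_kernel1.
  apply: is_derive_eq (is_derive_cheb_kernel0 _ _ n0 x1) _.
  by congr (_ / _); ring.
have [dK dK1] := IH (ltnW kn) x1.
have w0 := onem_sqr_gt0 _ x1.
split.
  apply: is_derive_eq dK1 _; rewrite cheb_kernelSS// -[k.+1]addn1 natrD.
  by field; rewrite gt_eqF.
have h : n%:R ^+ 2 - k.+1%:R ^+ 2 != 0 :> R.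
  by rewrite gt_eqF// subr_sqr_gt0.
pose a : R := 2 * k%:R + 1.
have d1 := is_derive_mul _ _ _ _ _ (is_derive_mul _ _ _ _ _ (is_derive_cst a x (1 : R))
  (is_derive_id x (1 : R))) dK1.
have d2 := is_derive_mul _ _ _ _ _ (is_derive_onem_sqr x) dK.
have := is_derive_mul _ _ _ _ _ (is_deriveB d1 d2)
  (is_derive_cst ((n%:R ^+ 2 - k.+1%:R ^+ 2)^-1 : R) x (1 : R)).
move=> H; apply: is_derive_eq H _; rewrite /cst/= -/(cheb_kernel n k.+1 x) /a.
move: (cheb_kernel _ _ _) (cheb_kernel n k x) h => A B; rewrite -[k.+1]addn1 natrD => h.
by field; rewrite (gt_eqF w0) h.
Qed.

(** * Size of the kernels *)

(** The kernel f = K_(m+1) satisfies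
    (1 - x^2) f'' + (2m - 1) x f' + (n^2 - m^2) f = 0.  Differentiating
    E = f^2 + (1 - x^2) f'^2 / (n^2 - m^2) and eliminating f'' leaves
    E' = - 4m x f'^2 / (n^2 - m^2), so E is largest at 0. *)
Lemma sonine_bound {R : realType} (n m : nat) (x : R) :
  (m < n)%N -> -1 < x < 1 ->
  cheb_kernel n m.+1 x ^+ 2 <=
  cheb_kernel n m.+1 0 ^+ 2 + cheb_kernel n m 0 ^+ 2 / (n%:R ^+ 2 - m%:R ^+ 2).
Proof.
move=> mn x1; set D : R := n%:R ^+ 2 - m%:R ^+ 2.
have D0 : 0 < D by exact: subr_sqr_gt0.
pose E (y : R) := cheb_kernel n m.+1 y * cheb_kernel n m.+1 y +
  (1 - y ^+ 2) * (cheb_kernel n m y * cheb_kernel n m y) * D^-1.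
pose dE (y : R) := - (4 * m%:R / D) * y * cheb_kernel n m y ^+ 2.
have EdE (y : R) : -1 < y < 1 -> is_derive y (1 : R) E (dE y).
  move=> y1; have [d1 d2] := is_derive_cheb_kernel n m y mn y1.
  have := is_derive_add _ _ _ _ _ (is_derive_mul _ _ _ _ _ d2 d2)
    (is_derive_mul _ _ _ _ _ (is_derive_mul _ _ _ _ _ (is_derive_onem_sqr y)
      (is_derive_mul _ _ _ _ _ d1 d1)) (is_derive_cst (D^-1 : R) y (1 : R))).
  move=> H; apply: is_derive_eq H _; rewrite /dE /cst -/D.
  have w0 := onem_sqr_gt0 y y1.
  move: (cheb_kernel _ _ _) (cheb_kernel n m y) => A B.
  by field; rewrite !gt_eqF.
have cE (a b : R) : -1 < a -> b < 1 -> {within `[a, b], continuous E}.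
  move=> a1 b1; apply: derivable_within_continuous => y; rewrite in_itv/= => /andP[ay yb].
  by have [] := EdE y ltac:(lra).
have c0 : 0 <= 4 * m%:R / D by rewrite mulr_ge0 ?mulr_ge0 ?invr_ge0// ltW.
have /andP[xl xr] := x1.
suff : E x <= E 0.
  rewrite /E expr0n/= subr0 mul1r -!expr2; apply: le_trans; rewrite lerDl.
  have w0 := ltW (onem_sqr_gt0 x x1).
  by rewrite mulr_ge0 ?invr_ge0 ?(ltW D0)// mulr_ge0 ?sqr_ge0.
have [x0|/ltW x0] := leP 0 x.
  have [y||c] := @MVT_segment _ E dE 0 x x0.
  - by rewrite in_itv/= => /andP[? ?]; apply: EdE; lra.
  - by apply: cE; lra.
  rewrite in_itv/= => /andP[c0' cx] H; rewrite -subr_le0 H subr0 /dE.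
  have h : 0 <= (4 * m%:R / D) * c * cheb_kernel n m c ^+ 2.
    by rewrite mulr_ge0 ?sqr_ge0// mulr_ge0.
  by rewrite !mulNr oppr_le0 mulr_ge0.
have [y||c] := @MVT_segment _ E dE x 0 x0.
- by rewrite in_itv/= => /andP[? ?]; apply: EdE; lra.
- by apply: cE; lra.
rewrite in_itv/= => /andP[xc c0'] H; rewrite -subr_ge0 H sub0r /dE.
rewrite mulr_ge0 ?oppr_ge0// mulr_ge0 ?sqr_ge0//.
by rewrite mulNr oppr_ge0 mulr_ge0_le0.
Qed.

Lemma trig_quarter_turns {R : realType} (n : nat) :
  (if odd n then cos (n%:R * (pi / 2) : R) = 0 /\ `|sin (n%:R * (pi / 2) : R)| = 1
   else `|cos (n%:R * (pi / 2) : R)| = 1 /\ sin (n%:R * (pi / 2) : R) = 0).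
Proof.
elim/ltn_ind: n => -[|[|n]] IH.
- by rewrite mul0r cos0 sin0 normr1.
- by rewrite mul1r cos_pihalf sin_pihalf normr1.
- have := IH n ltac:(by []); rewrite -[n.+2]addn2 natrD (mulrDl n%:R) oddD addbF.
  have -> : 2 * (pi / 2) = pi :> R by field.
  by rewrite cosDpi sinDpi !normrN; case: ifP => _ [-> ->]; rewrite ?oppr0.
Qed.

(** At 0 the recurrence reads (n^2 - (k+1)^2) K_(k+2)(0) = - K_k(0): parity is
    preserved, and n^2 - (k+1)^2 = (n - k - 1)(n + k + 1) contributes the two
    outermost factors of the product. *)
Lemma cheb_kernel_at0 {R : realType} (n k : nat) : (0 < n)%N -> (k <= n)%N ->
  if odd (n - k) then cheb_kernel n k 0 = 0 :> R
  else `|cheb_kernel n k 0| =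
         \prod_(0 <= j < k) (n - k + 2 * j + 1)%:R^-1 :> R.
Proof.
move=> n0; elim/ltn_ind: k => -[|[|k]] IH kn.
- have := @trig_quarter_turns R n.
  rewrite subn0 big_nil /= /chebyshevT acos0 expr0n/= subr0 sqrtr1 divr1.
  by case: ifP => _ [].
- case: n n0 {IH kn} => // n _; have := @trig_quarter_turns R n.+1.
  rewrite big_nat1 subn1 muln0 addn0 addn1 /= acos0.
  case: (odd n) => /= -[h1 h2]; first by rewrite h2 mul0r.
  by rewrite normrM h2 mul1r ger0_norm ?invr_ge0.
- have D0 : n%:R ^+ 2 - k.+1%:R ^+ 2 != 0 :> R.
    by rewrite gt_eqF// subr_sqr_gt0.
  have H : (n%:R ^+ 2 - k.+1%:R ^+ 2) * cheb_kernel n k.+2 0 = - cheb_kernel n k 0 :> R.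
    by rewrite cheb_kernelSS// mulr0 mul0r sub0r expr0n/= subr0 mul1r.
  have {}H : cheb_kernel n k.+2 0 = - cheb_kernel n k 0 / (n%:R ^+ 2 - k.+1%:R ^+ 2) :> R.
    by apply: (mulfI D0); rewrite H mulrC mulfVK.
  rewrite H; have := IH k ltac:(by []) (leq_trans (leqnSn _) (ltnW kn)).
  have -> : (n - k = (n - k.+2) + 2)%N by lia.
  rewrite oddD addbF; case: ifP => _; first by move=> ->; rewrite oppr0 mul0r.
  rewrite normrM normrN => ->.
  have -> : \prod_(0 <= j < k) (n - k.+2 + 2 + 2 * j + 1)%:R^-1 =
    \prod_(0 <= j < k) (n - k.+2 + 2 * j.+1 + 1)%:R^-1 :> R.
    by apply: eq_bigr => j _; congr (_%:R^-1); lia.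
  rewrite [RHS]big_nat_recl//= [in RHS]big_nat_recr//= mulrCA; congr (_ * _).
  rewrite muln0 addn0 -invfM -natrM normfV ger0_norm; last first.
    by rewrite subr_ge0 -!natrX ler_nat leq_exp2r// ltnW.
  congr (_^-1); rewrite -!natrX -natrB ?leq_exp2r// ?(ltnW kn)//; congr (_%:R).
  rewrite subn_sqr; nia.
Qed.

Lemma sin_natmul_le {R : realType} (n : nat) (t : R) :
  `|sin (n%:R * t)| <= n%:R * `|sin t|.
Proof.
elim: n => [|n IH]; first by rewrite !mul0r sin0 normr0.
rewrite -[n.+1]addn1 natrD !mulrDl !mul1r sinD (le_trans (ler_normD _ _))//.
rewrite !normrM lerD//.
  by rewrite -[leRHS]mulr1 ler_pM// cos_max.
by rewrite -[leRHS]mul1r ler_pM// cos_max.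
Qed.

(** The recurrence propagates this decay, starting from |sin (n t)| <= n |sin t|
    for K_1 and from (1 - x^2) K_0 = sqrt (1 - x^2) T_n for K_0, whose own
    singularity is compensated by the factor 1 - x^2. *)
Lemma cheb_kernel_sqrt_bound {R : realType} (n k : nat) : (0 < n)%N ->
  exists C : R, forall x, -1 < x < 1 ->
    `|cheb_kernel n k.+1 x| <= C * Num.sqrt (1 - x ^+ 2).
Proof.
move=> n0; suff [] : (exists C : R, forall x, -1 < x < 1 ->
    `|(1 - x ^+ 2) * cheb_kernel n k x| <= C * Num.sqrt (1 - x ^+ 2)) /\
  (exists C : R, forall x, -1 < x < 1 ->
    `|cheb_kernel n k.+1 x| <= C * Num.sqrt (1 - x ^+ 2)) by [].
elim: k => [|k [[C HC] [C' HC']]].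
  split; exists (1 : R) => x x1; have w0 := onem_sqr_gt0 x x1; rewrite mul1r.
    rewrite /= mulrCA -{1}(sqr_sqrtr (ltW w0)) expr2 mulfK ?gt_eqF ?sqrtr_gt0//.
    by rewrite normrM -[leRHS]mul1r ler_pM// ?cos_max// ger0_norm ?sqrtr_ge0.
  have /andP[xl xr] := x1.
  rewrite /= normrM [X in _ * X]ger0_norm ?invr_ge0// ler_pdivrMr ?ltr0n//.
  rewrite [leRHS]mulrC -sin_acos; last by lra.
  apply: le_trans (sin_natmul_le _ _) _; rewrite ler_wpM2l// ger0_norm//.
  by rewrite sin_acos ?sqrtr_ge0//; lra.
split.
  exists C' => x x1; have w0 := onem_sqr_gt0 x x1.
  apply: le_trans (HC' _ x1); rewrite normrM ler_piMl// ger0_norm ?(ltW w0)//.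
  by have := sqr_ge0 x; lra.
exists ((`|2 * k%:R + 1| * C' + C) / `|n%:R ^+ 2 - k.+1%:R ^+ 2|) => x x1.
rewrite [cheb_kernel n k.+2 x]/= -/(cheb_kernel n k.+1 x) normrM normfV [leRHS]mulrAC.
rewrite ler_wpM2r ?invr_ge0// (le_trans (ler_normB _ _))// [leRHS]mulrDl lerD//; last exact: HC.
rewrite !normrM -!mulrA ler_wpM2l//; apply: le_trans (HC' _ x1).
have /andP[xl xr] := x1.
by rewrite ler_piMl// ler_norml; lra.
Qed.

(** * Bounded variation on an open interval *)

Lemma total_variation_le_oo {R : realType} (a b c d : R) (f : R -> R) :
  a < c -> c <= d -> d < b ->
  (total_variation c d f <= total_variation_oo a b f)%E.
Proof. by move=> ac cd db; apply: ereal_sup_ubound; exists c, d. Qed.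

(** V is the variation from c on. *)
Lemma bv_oo_dominated {R : realType} (a b c d : R) (f : R -> R) :
  (total_variation_oo a b f < +oo)%E -> a < c -> c <= d -> d < b ->
  exists V : R -> R, V d - V c <= fine (total_variation_oo a b f) /\
    forall x y, c <= x -> x <= y -> y <= d -> `|f y - f x| <= V y - V x.
Proof.
move=> fbv ac cd db.
have tvfin x y : c <= x -> x <= y -> y <= d -> total_variation x y f \is a fin_num.
  move=> cx xy yd; rewrite ge0_fin_numE ?total_variation_ge0//.
  by apply: le_lt_trans fbv; apply: total_variation_le_oo; lra.
exists (fun x => fine (total_variation c x f)); split.
  rewrite total_variationxx subr0 fine_le ?tvfin//; last exact: total_variation_le_oo.
  rewrite ge0_fin_numE//; apply: le_trans (total_variation_le_oo _ _ c d f ac cd db).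
  exact: total_variation_ge0.
move=> x y cx xy yd; have xd := le_trans xy yd.
rewrite (total_variationD f cx xy) fineD ?tvfin//.
rewrite addrAC subrr add0r -lee_fin fineK ?tvfin//.
exact: total_variation_ge.
Qed.

Lemma bv_oo_bounded {R : realType} (a b : R) (f : R -> R) :
  (total_variation_oo a b f < +oo)%E ->
  exists B, forall x, a < x < b -> `|f x| <= B.
Proof.
move=> fbv; pose p := (a + b) / 2.
exists (`|f p| + fine (total_variation_oo a b f)) => x /andP[ax xb].
have H y z : a < y -> y <= z -> z < b ->
    `|f z - f y| <= fine (total_variation_oo a b f).
  move=> ay yz zb; have [V [HV Vf]] := bv_oo_dominated _ _ _ _ _ fbv ay yz zb.
  by apply: le_trans (Vf y z _ _ _) HV.
have ap : a < p by rewrite /p; lra.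
have pb : p < b by rewrite /p; lra.
have {}H : `|f x - f p| <= fine (total_variation_oo a b f).
  by have [/ltW xp|px] := ltP x p; [rewrite distrC|]; exact: H.
by rewrite -[f x](subrK (f p)) addrC (le_trans (ler_normD _ _))// lerD2l.
Qed.

Lemma nondecreasing_on_measurable {R : realType} (D : set R) (f : R -> R) :
  is_interval D -> {in D &, nondecreasing_fun f} ->
  measurable_fun D f.
Proof.
move=> iD f_nd mD; apply: (measurability (@RGenCInfty.G R)) => //.
  exact: RGenCInfty.measurableE.
move=> /= _ [_ [r -> <-]]; apply: is_interval_measurable => s t/=.
rewrite !in_itv/= !andbT => -[Ds fs] [Dt ft] z /andP[sz zt].
have Dz : D z by apply: iD Ds Dt _ _; rewrite ?sz.
by split => //; rewrite in_itv/= andbT (le_trans fs)// f_nd// inE.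
Qed.

Lemma itvoo_N11_bigcup {R : realType} :
  `]-1, 1[%classic = \bigcup_k `[- (1 - k.+2%:R^-1), 1 - k.+2%:R^-1]%classic :> set R.
Proof.
apply/seteqP; split => x; rewrite /= in_itv/=; last first.
  move=> [k _] /=; rewrite in_itv/=.
  have : 0 < k.+2%:R^-1 :> R by rewrite invr_gt0.
  by move: (k.+2%:R^-1) => e e0 /andP[? ?]; lra.
move=> /andP[x1 x2]; have : `|x| < 1 by rewrite ltr_norml x1.
move=> /ltr_add_invr[k xk]; exists k => //=; rewrite in_itv/= -ler_norml.
have : k.+2%:R^-1 <= k.+1%:R^-1 :> R by rewrite lef_pV2 ?posrE// ler_nat.
move: (k.+2%:R^-1) (k.+1%:R^-1) xk => e e' h h'; lra.
Qed.

(** With V as in [bv_oo_dominated], f = V - (V - f) is a difference of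
    nondecreasing functions on each compact subinterval. *)
Lemma bv_oo_measurable {R : realType} (f : R -> R) :
  (total_variation_oo (-1) 1 f < +oo)%E ->
  measurable_fun (`]-1, 1[%classic : set R) f.
Proof.
move=> fbv; rewrite itvoo_N11_bigcup; apply/measurable_fun_bigcup => [//|k].
set c : R := 1 - k.+2%:R^-1.
have [c0 c1] : 0 < c /\ c < 1.
  by rewrite /c subr_gt0 invf_lt1// ltr1n/= ltrBlDr ltrDl invr_gt0 ltr0n.
have [V [_ Vf]] := bv_oo_dominated _ _ (- c) c f fbv ltac:(lra) ltac:(lra) c1.
apply: (eq_measurable_fun (fun x => V x - (V x - f x))).
  by move=> x _; rewrite subKr.
apply: measurable_funB; apply: nondecreasing_on_measurable;
  try exact: interval_is_interval.
- move=> x y; rewrite !inE/= !in_itv/= => /andP[cx _] /andP[_ yc] xy.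
  by rewrite -subr_ge0 (le_trans _ (Vf x y cx xy yc)).
- move=> x y; rewrite !inE/= !in_itv/= => /andP[cx _] /andP[_ yc] xy.
  have := Vf x y cx xy yc; have := ler_norm (f y - f x); lra.
Qed.

(** * Integrability and the primitive *)

(** On compact subintervals the integral is a difference of values of arccos,
    hence at most pi; the exhaustion of ]-1, 1[ by such intervals and monotone
    convergence do the rest. *)
Lemma arcsine_weight_integrable {R : realType} :
  (@lebesgue_measure R).-integrable `]-1, 1[
    (fun x => ((Num.sqrt (1 - x ^+ 2))^-1)%:E).
Proof.
pose w (x : R) : R := (Num.sqrt (1 - x ^+ 2))^-1.
have dw (x : R) : -1 < x < 1 -> derivable w x 1.
  by move=> x1; case: (is_derive_arcsine_weight x x1).
have mw : measurable_fun (`]-1, 1[%classic : set R) w.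
  apply: open_continuous_measurable_fun => //.
  move=> x; rewrite inE/= in_itv/= => /dw /derivable1_diffP.
  exact: differentiable_continuous.
have w0 x : 0 <= w x by rewrite invr_ge0 sqrtr_ge0.
apply/integrableP; split; first exact/measurable_EFinP.
under eq_integral do rewrite gee0_abs ?lee_fin//.
apply: (@le_lt_trans _ _ (pi : R)%:E); last by rewrite ltry.
pose A (k : nat) : R := 1 - k.+2%:R^-1.
have A01 k : 0 < A k < 1.
  rewrite /A subr_gt0 invf_lt1// ltr1n/= ltrBlDr ltrDl invr_gt0 ltr0n//.
rewrite itvoo_N11_bigcup.
pose F (k : nat) : set R := `[- A k, A k]%classic.
have ndF : nondecreasing_seq F.
  move=> k l kl; apply/subsetPset => x /=; rewrite /F/= !in_itv/=.
  have : A k <= A l by rewrite lerB// lef_pV2 ?posrE// ler_nat !ltnS.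
  by move=> ? /andP[? ?]; lra.
have mF k : measurable (F k) by exact: measurable_itv.
have mFw k : measurable_fun (F k) (EFin \o w).
  apply/measurable_EFinP; apply: measurable_funS mw => //.
  have /andP[A0 A1] := A01 k.
  by move=> x /=; rewrite /F/= !in_itv/= => /andP[? ?]; lra.
have Fw0 k x : F k x -> (0 <= (EFin \o w) x)%E by move=> _; rewrite lee_fin.
have cvgF := @ge0_nondecreasing_set_cvg_integral _ _ _ _ _ (@lebesgue_measure R) ndF mF mFw Fw0.
rewrite -(cvg_lim _ cvgF)//; apply: lime_le.
  by apply/cvg_ex; eexists; exact: cvgF.
near=> k; have /andP[A0 A1] := A01 k.
have dN (x : R) : -1 < x < 1 -> is_derive x (1 : R) (fun x => - acos x) (w x).
  by move=> x1; apply: is_derive_eq (is_deriveN (is_derive1_acos x1)) _; rewrite opprK.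
have cN (x : R) : -1 < x < 1 -> {for x, continuous (fun x => - @acos R x)}.
  move=> x1; apply: differentiable_continuous; apply/derivable1_diffP.
  by case: (dN x x1).
rewrite (@continuous_FTC2 _ w (fun x => - acos x)).
- rewrite -EFinB lee_fin.
  have := @acos_ge0 _ (A k); have := @acos_lepi _ (- A k).
  by lra.
- by lra.
- by apply: derivable_within_continuous => x; rewrite in_itv/= => /andP[? ?]; apply: dw; lra.
- split.
  + by move=> x; rewrite in_itv/= => /andP[? ?]; case: (dN x) => //; lra.
  + by apply: cvg_at_right_filter; apply: cN; lra.
  + by apply: cvg_at_left_filter; apply: cN; lra.
- move=> x; rewrite in_itv/= => /andP[? ?]; rewrite derive1E.
  by case: (dN x) => //; lra.
Unshelve. all: by end_near.
Qed.

Lemma cheb_kernel0_integrable {R : realType} (u : R -> R) (n : nat) (B : R) :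
  (0 < n)%N ->
  measurable_fun (`]-1, 1[%classic : set R) u ->
  (forall x, -1 < x < 1 -> `|u x| <= B) ->
  (@lebesgue_measure R).-integrable `]-1, 1[
    (EFin \o (fun x => u x * cheb_kernel n 0 x)).
Proof.
move=> n0 mu uB.
have iB : (@lebesgue_measure R).-integrable `]-1, 1[
    (fun x => B%:E * ((Num.sqrt (1 - x ^+ 2))^-1)%:E)%E.
  by apply: integrableZl => //; exact: arcsine_weight_integrable.
apply: le_integrable iB => //.
  apply/measurable_EFinP; apply: measurable_funM => //.
  apply: open_continuous_measurable_fun => //.
  move=> x; rewrite inE/= in_itv/= => x1.
  apply: differentiable_continuous; apply/derivable1_diffP.
  by have [[]] := is_derive_cheb_kernel n 0 x n0 x1.
move=> x; rewrite /= in_itv/= => x1; rewrite lee_fin !normrM.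
rewrite mulrA ler_wpM2r// -[leRHS]mulr1 ler_pM//; last exact: cos_max.
by apply: le_trans (uB _ x1) _; exact: ler_norm.
Qed.

Section primitive.
Context {R : realType} (a b : R) (w : R -> R)
  (iw : (@lebesgue_measure R).-integrable `]a, b[ (EFin \o w)).

(** Extending w by 0 outside ]a, b[ makes the integrand integrable on the whole
    line, as Lebesgue's differentiation theorem wants it, whatever w is
    there. *)
Definition primitive (x : R) : R :=
  \int[@lebesgue_measure R]_(t in `[a, x]) (w \_ `]a, b[) t.

Let ig : (@lebesgue_measure R).-integrable setT (EFin \o (w \_ `]a, b[)).
Proof. by rewrite -restrict_EFin; apply: (integrable_mkcond _ _).1 => //; exact: iw. Qed.

Let igS (D : set R) : measurable D ->
  (@lebesgue_measure R).-integrable D (EFin \o (w \_ `]a, b[)).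
Proof. by move=> mD; apply: integrableS ig. Qed.

Lemma is_derive_primitive :
  {ae @lebesgue_measure R, forall x, a < x < b -> is_derive x (1 : R) primitive (w x)}.
Proof.
have F1 := @FTC1 R (w \_ `]a, b[) (BLeft a) (fun y => igS _ (measurable_itv _))
  (integrable_locally (measurable_itv _) iw).
have FF := ae_filter_ringOfSetsType (@lebesgue_measure R).
apply: (@filterS _ _ FF _ _ _ F1) => x H /andP[ax xb]; have [] := H ax.
have xab : x \in `]a, b[%classic by rewrite inE/= in_itv/= ax.
rewrite derive1E patchE xab => d1 d2.
by split.
Qed.

Lemma primitive_lipschitz (c d B : R) : a < c -> d < b ->
  (forall x, c <= x <= d -> `|w x| <= B) ->
  forall x y, c <= x -> x <= y -> y <= d ->
    `|primitive y - primitive x| <= B * (y - x).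
Proof.
move=> ac db wB x y cx xy yd; rewrite /primitive Rintegral_itvB//; last 2 first.
- by apply: igS.
- by rewrite bnd_simp; lra.
apply: le_trans (le_normr_Rintegral _ _) _ => //; first by apply: igS.
have muE : @lebesgue_measure R `]x, y]%classic = (y - x)%:E.
  rewrite lebesgue_measure_itv/= lte_fin; case: ltP => // yx.
  by have -> : y = x; [lra|rewrite subrr].
have -> : B * (y - x) = \int[@lebesgue_measure R]_(_ in `]x, y]) B.
  transitivity (B * fine (@lebesgue_measure R `]x, y]%classic)); first by rewrite muE.
  by rewrite Rintegral_cst.
apply: le_Rintegral => //.
- by apply: integrable_norm; apply: igS.
- apply: measurable_bounded_integrable => //.
    by apply: (@le_lt_trans _ _ (y - x)%:E); [rewrite -muE|rewrite ltry].
  by exists `|B|; split => // M BM z _ /=; exact: ltW.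
- move=> t /=; rewrite in_itv/= => /andP[xt ty].
  have tab : t \in `]a, b[%classic by rewrite inE/= in_itv/=; lra.
  by rewrite patchE tab wB//; lra.
Qed.

Lemma primitive_cvg : a < b ->
  primitive @ a^'+ --> 0 /\
  primitive @ b^'- --> \int[@lebesgue_measure R]_(t in `]a, b[) w t.
Proof.
move=> ab.
have := parameterized_integral_continuous (ltW ab) (igS _ (measurable_itv `[a, b])).
move=> /(continuous_within_itvP _ ab)[_].
rewrite /parameterized_integral set_itv1 Rintegral_set1 => h1.
have -> : \int[lebesgue_measure]_(t in `[a, b]) (w \_ `]a, b[) t =
  \int[@lebesgue_measure R]_(t in `]a, b[) w t.
  rewrite -Rintegral_mkcondr; congr Rintegral.
  apply/seteqP; split => x /=; rewrite !in_itv/=; first by case.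
  by move=> /andP[ax xb]; rewrite ax xb !ltW.
by [].
Qed.

End primitive.

Lemma derivable_bounded {R : realType} (f : R -> R) (c d : R) :
  (forall x, c <= x <= d -> derivable f x 1) ->
  exists B, forall x, c <= x <= d -> `|f x| <= B.
Proof.
move=> df; have [cd|dc] := leP c d; last by exists 0 => x /andP[cx xd]; lra.
have cf : {within `[c, d], continuous f}.
  by apply: derivable_within_continuous => x; rewrite in_itv/=; exact: df.
have [y _ My] := EVT_max cd cf; have [z _ mz] := EVT_min cd cf.
exists (Num.max `|f y| `|f z|) => x xcd.
have := My x; have := mz x; rewrite in_itv/= => /(_ xcd) h1 /(_ xcd) h2.
rewrite le_max; have [f0|/ltW f0] := leP 0 (f x).
  by rewrite ger0_norm// (le_trans h2)// ler_norm.
apply/orP; right; rewrite ler0_norm// (le_trans (y := - f z)) ?lerN2//.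
by rewrite -normrN ler_norm.
Qed.

Lemma cheb_kernel_bounded {R : realType} (n k : nat) (c d : R) : (k < n)%N ->
  -1 < c -> d < 1 -> exists B, forall x, c <= x <= d -> `|cheb_kernel n k x| <= B.
Proof.
move=> kn c1 d1; apply: derivable_bounded => x /andP[cx xd].
by have [[]] := is_derive_cheb_kernel n k x kn ltac:(lra).
Qed.

Lemma cheb_kernel_absolutely_continuous {R : realType} (n k : nat) (c d : R) :
  (k < n)%N -> -1 < c -> d < 1 ->
  absolutely_continuous_on c d (cheb_kernel n k.+1).
Proof.
move=> kn c1 d1; have [B HB] := cheb_kernel_bounded n k c d kn c1 d1.
apply: (@lipschitz_absolutely_continuous _ _ _ B) => x y cx xy yd.
have dK t : x <= t <= y ->
    is_derive t (1 : R) (cheb_kernel n k.+1) (- cheb_kernel n k t).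
  by move=> /andP[xt ty]; have [] := is_derive_cheb_kernel n k t kn ltac:(lra).
have [t||t] := @MVT_segment _ (cheb_kernel n k.+1) (fun t => - cheb_kernel n k t) x y xy.
- by rewrite in_itv/= => /andP[? ?]; apply: dK; rewrite !ltW.
- apply: derivable_within_continuous => t; rewrite in_itv/= => /dK.
  by case.
rewrite in_itv/= => /andP[xt ty] ->.
rewrite normrM normrN (ger0_norm (_ : 0 <= y - x)) ?subr_ge0//.
by rewrite ler_wpM2r ?subr_ge0// HB//; lra.
Qed.

(** * Coefficients and total variation *)

Lemma uniform_bound_upto {R : realType} (P : R -> Prop) (m : nat) (v : nat -> R -> R) :
  (forall k, (k <= m)%N -> exists B, forall x, P x -> `|v k x| <= B) ->
  exists B, forall k x, (k <= m)%N -> P x -> `|v k x| <= B.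
Proof.
elim: m => [|m IH] Hv.
  by have [B HB] := Hv 0%N isT; exists B => k x; rewrite leqn0 => /eqP ->; exact: HB.
have [B HB] := IH (fun k km => Hv k (leqW km)); have [C HC] := Hv m.+1 (leqnn _).
exists (Num.max B C) => k x; rewrite leq_eqVlt le_max ltnS => /predU1P[->|km] Px.
  by rewrite HC// orbT.
by rewrite HB.
Qed.

Section chebyshev_integral.
Context {R : realType} (m n : nat) (u : R -> R) (v : nat -> R -> R) (M : R)
  (hv : derivatives_upto m u v)
  (hAC : forall k, (k < m)%N -> absolutely_continuous_on (-1) 1 (v k))
  (hBV : (total_variation_oo (-1)%R 1%R (v m) < +oo)%E)
  (mn : (m < n)%N)
  (KM : forall x, -1 < x < 1 -> `|cheb_kernel n m.+1 x : R| <= M).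

Let n0 : (0 < n)%N. Proof. exact: leq_ltn_trans mn. Qed.

Let v_bounded : exists B, forall k x, (k <= m)%N -> -1 < x < 1 -> `|v k x| <= B.
Proof.
apply: uniform_bound_upto => k; rewrite leq_eqVlt => /predU1P[->|km].
  exact: bv_oo_bounded.
have [B HB] := absolutely_continuous_bounded _ _ _ (hAC k km).
by exists B => x /andP[x1 x2]; apply: HB; rewrite !ltW.
Qed.

Let uv x : -1 < x < 1 -> v 0%N x = u x.
Proof. by case: hv => H _ _ /andP[x1 x2]; apply: H; rewrite !ltW. Qed.

Let u_measurable : measurable_fun (`]-1, 1[%classic : set R) u.
Proof.
apply: (eq_measurable_fun (v 0%N)).
  by move=> x; rewrite inE/= in_itv/=; exact: uv.
have [m0|m0] := posnP m; first by rewrite -m0; exact: bv_oo_measurable.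
apply: open_continuous_measurable_fun => // x; rewrite inE/= in_itv/=.
exact: absolutely_continuous_continuous (hAC 0%N m0).
Qed.

Let w (x : R) : R := u x * cheb_kernel n 0 x.

Let iw : (@lebesgue_measure R).-integrable `]-1, 1[ (EFin \o w).
Proof.
have [B HB] := v_bounded; apply: (cheb_kernel0_integrable u n B) => // x x1.
by rewrite -uv// HB.
Qed.

Let J := primitive (-1) 1 w.

Let boundary (k : nat) (x : R) : R := v k x * cheb_kernel n k.+1 x.

(** Adding v_k' K_(k+1) - v_k K_k = v_(k+1) K_(k+1) - v_k K_k over k < m
    leaves v_m K_m - u K_0: the second term cancels the derivative of J, the
    first one that of K_(m+1) times the constant v_m(x). *)
Let is_derive_total :
  {ae @lebesgue_measure R, forall x : R, -1 < x < 1 ->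
    is_derive x (1 : R)
      (fun y => (J y + \sum_(0 <= k < m) boundary k y) + v m x * cheb_kernel n m.+1 y) 0}.
Proof.
have FF := ae_filter_ringOfSetsType (@lebesgue_measure R).
have dv : {ae @lebesgue_measure R, forall x : R, -1 < x < 1 ->
    forall k, (k < m)%N -> is_derive x (1 : R) (v k) (v k.+1 x)}.
  have [_ h1 h2] := hv.
  have [m0|m0] := posnP m; first by apply: aeW => x _ k; rewrite m0.
  apply: (@filterS _ _ FF _ _ _ (h2 m0)) => x H x1 k km.
  have [km'|km'] := ltnP k.+1 m; first exact: h1.
  have km1 : k = m.-1 by lia.
  have -> : k.+1 = m by lia.
  by rewrite km1; exact: H.
apply: (@filterS2 _ _ FF _ _ _ _ (is_derive_primitive _ _ _ iw) dv) => x dJ {}dv x1.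
have dK k : (k <= m)%N -> is_derive x (1 : R) (cheb_kernel n k.+1) (- cheb_kernel n k x).
  by move=> km; have [] := is_derive_cheb_kernel n k x (leq_ltn_trans km mn) x1.
pose f k := v k x * cheb_kernel n k x.
have db : is_derive x (1 : R) (fun y => \sum_(0 <= k < m) boundary k y) (f m - f 0%N).
  rewrite -telescope_sumr//; apply: is_derive_bigsum => k km.
  apply: is_derive_eq (is_derive_mul _ _ _ _ _ (dv x1 k km) (dK k (ltnW km))) _.
  by rewrite /f; ring.
have dF := is_derive_mul _ _ _ _ _ (is_derive_cst (v m x) x (1 : R)) (dK m (leqnn m)).
apply: is_derive_eq (is_derive_add _ _ _ _ _ (is_derive_add _ _ _ _ _ (dJ x1) db) dF) _.
by rewrite /f /w /cst (uv x x1); ring.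
Qed.

Let boundary_bound : exists A, forall x, -1 < x < 1 ->
  `|\sum_(0 <= k < m.+1) boundary k x| <= A * Num.sqrt (1 - x ^+ 2).
Proof.
have [B HB] := v_bounded.
suff H j : (j <= m.+1)%N -> exists A, forall x, -1 < x < 1 ->
    `|\sum_(0 <= k < j) boundary k x| <= A * Num.sqrt (1 - x ^+ 2) by exact: H.
elim: j => [|j IH] jm; first by exists 0 => x _; rewrite big_nil normr0 mul0r.
have [A HA] := IH (ltnW jm); have [C HC] := cheb_kernel_sqrt_bound n j n0 (R := R).
exists (A + B * C) => x x1; rewrite big_nat_recr//= mulrDl.
rewrite (le_trans (ler_normD _ _))// lerD ?HA// normrM -mulrA.
by rewrite ler_pM ?HB ?HC.
Qed.

Let primitive_increment (d : R) : 0 < d < 1 ->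
  `|J d - J (- d)| <= M * fine (total_variation_oo (-1) 1 (v m)) +
    (`|\sum_(0 <= k < m.+1) boundary k d| + `|\sum_(0 <= k < m.+1) boundary k (- d)|).
Proof.
move=> /andP[d0 d1].
have cd : - d <= d by lra.
have ac : -1 < - d by lra.
have I1 x : - d <= x <= d -> -1 < x < 1 by move=> /andP[? ?]; lra.
have [V [Vdc Vv]] := bv_oo_dominated _ _ _ _ _ hBV ac cd d1.
have [B HB] := v_bounded.
have acJ : absolutely_continuous_on (- d) d J.
  have [C HC] := cheb_kernel_bounded n 0 (- d) d n0 ac d1.
  apply: (lipschitz_absolutely_continuous _ _ (B * C)).
  apply: (primitive_lipschitz _ _ _ iw) => // x xd.
  by rewrite /w normrM ler_pM// ?HC// -uv ?HB// ?I1.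
have acF k : (k <= m)%N -> absolutely_continuous_on (- d) d (cheb_kernel n k.+1).
  by move=> km; apply: cheb_kernel_absolutely_continuous => //; exact: leq_ltn_trans mn.
have acH : absolutely_continuous_on (- d) d
    (fun y => J y + \sum_(0 <= k < m) boundary k y).
  apply: absolutely_continuousD => //; apply: absolutely_continuous_bigsum => k km.
  have [C HC] := cheb_kernel_bounded n k.+1 (- d) d (leq_ltn_trans km mn) ac d1.
  apply: (absolutely_continuousM _ _ (Num.max B C)).
  - by move=> x xd; rewrite le_max HB ?I1// ltnW.
  - by move=> x xd; rewrite le_max HC ?orbT.
  - by apply: absolutely_continuous_sub (hAC k km); exact: ltW.
  - exact: acF (ltnW km).
have := stieltjes_bound (- d) d M _ (cheb_kernel n m.+1) (v m) V cd acH (acF m (leqnn m)).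
move=> /(_ _ Vv _)H.
have {}H : `|(J d + \sum_(0 <= k < m.+1) boundary k d) -
    (J (- d) + \sum_(0 <= k < m.+1) boundary k (- d))| <=
    M * fine (total_variation_oo (-1) 1 (v m)).
  rewrite !big_nat_recr//= !addrA; apply: le_trans (H _ _) _.
  - by move=> x xd; apply: KM; exact: I1.
  - have FF := ae_filter_ringOfSetsType (@lebesgue_measure R).
    by apply: (@filterS _ _ FF _ _ _ is_derive_total) => x dH xd; apply: dH; exact: I1.
  - by rewrite ler_wpM2l// (le_trans _ (KM 0 _))// ltrN10 ltr01.
set S := \sum_(_ <= _ < _) _ in H *; set T := \sum_(_ <= _ < _) _ in H *.
have -> : J d - J (- d) = (J d + S - (J (- d) + T)) + (T - S) by ring.
apply: le_trans (ler_normD _ _) _; rewrite lerD// [leRHS]addrC; exact: ler_normB.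
Qed.

(** The bound of [primitive_increment] passes to the limit d -> 1, as the
    boundary terms are at most a multiple of sqrt (1 - d^2). *)
Lemma chebyshev_coef_le :
  (`|chebyshev_coef u n|%:E <= (2 / pi * M)%:E * total_variation_oo (-1)%R 1%R (v m))%E.
Proof.
have tv_fin : total_variation_oo (-1)%R 1%R (v m) \is a fin_num.
  rewrite ge0_fin_numE//; apply: le_trans (total_variation_le_oo _ _ 0 0 (v m) _ _ _) => //.
  by rewrite total_variation_ge0.
rewrite -(fineK tv_fin) -EFinM lee_fin.
have pi0 : 0 < 2 / pi :> R by rewrite divr_gt0// pi_gt0.
rewrite /chebyshev_coef normrM (gtr0_norm pi0) -[leRHS]mulrA ler_pM2l//.
under eq_Rintegral do rewrite -mulrA.
rewrite -/(Rintegral _ _ w).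
have [A HA] := boundary_bound.
have N11 : -1 < 1 :> R by lra.
have [c1 c2] := primitive_cvg _ _ _ iw N11.
apply/ler_addgt0Pr => e e0.
have e3 : 0 < e / 4 by rewrite divr_gt0.
have h1 := proj1 (cvgrPdist_lt _ _) c2 _ e3.
have c1' : (J \o -%R) @ 1^'- --> (0 : R).
  by apply/cvg_at_leftNP; apply: cvg_trans c1; apply: near_eq_cvg; near=> x; rewrite /= opprK.
have h2 := proj1 (cvgrPdist_lt _ _) c1' _ e3.
have c3 : (fun d : R => A * Num.sqrt (1 - d ^+ 2)) @ 1^'- --> (0 : R).
  have cq : {for 1, continuous (fun d : R => 1 - d ^+ 2)}.
    apply: differentiable_continuous; apply/derivable1_diffP.
    by case: (is_derive_onem_sqr (1 : R)).
  have cs : Num.sqrt (1 - d ^+ 2) @[d --> (1 : R)] --> Num.sqrt (1 - 1 ^+ 2 : R).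
    by apply: (continuous_comp cq); exact: sqrt_continuous.
  have -> : 0 = A * Num.sqrt (1 - 1 ^+ 2) :> R by rewrite expr1n subrr sqrtr0 mulr0.
  by apply: cvg_at_left_filter; apply: cvgMr.
have h3 := proj1 (cvgrPdist_lt _ _) c3 _ e3.
near (1 : R)^'- => d.
have d01 : 0 < d < 1.
  by apply/andP; split; near: d; [exact: nbhs_left_gt|exact: nbhs_left_lt].
have H1 : `|\int[lebesgue_measure]_(t in `]-1, 1[) w t - J d| < e / 4 by near: d; exact: h1.
have H2 : `|0 - J (- d)| < e / 4 by near: d; exact: h2.
have H3 : `|0 - A * Num.sqrt (1 - d ^+ 2)| < e / 4 by near: d; exact: h3.
have H4 := primitive_increment d d01.
have /andP[d0 d1] := d01.
have H5 := HA d ltac:(lra).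
have H6 := HA (- d) ltac:(lra).
rewrite sqrrN in H6; rewrite sub0r normrN in H2; rewrite sub0r normrN in H3.
have H7 := ler_norm (A * Num.sqrt (1 - d ^+ 2)).
set I := Rintegral _ _ _ in H1 *.
have -> : I = (I - J d) + (J d - J (- d)) + J (- d) by ring.
apply: le_trans (ler_normD _ _) _.
have := ler_normD (I - J d) (J d - J (- d)).
lra.
Unshelve. all: by end_near.
Qed.

End chebyshev_integral.

Lemma cheb_kernel_le_odd {R : realType} (n m : nat) (x : R) :
  (m < n)%N -> odd (n - m) -> -1 < x < 1 ->
  `|cheb_kernel n m.+1 x| <= \prod_(0 <= j < m.+1) (n - m + 2 * j)%:R^-1.
Proof.
move=> mn nm x1; have n0 : (0 < n)%N by exact: leq_ltn_trans mn.
have := cheb_kernel_at0 n m n0 (ltnW mn) (R := R); rewrite nm => Km0.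
have := cheb_kernel_at0 n m.+1 n0 mn (R := R).
have nmE : (n - m = (n - m.+1).+1)%N by lia.
have -> : odd (n - m.+1) = false by move: nm; rewrite nmE /= => /negbTE.
have -> : \prod_(0 <= j < m.+1) (n - m.+1 + 2 * j + 1)%:R^-1 =
    \prod_(0 <= j < m.+1) (n - m + 2 * j)%:R^-1 :> R.
  by apply: eq_bigr => j _; congr (_%:R^-1); lia.
move=> <-; have := sonine_bound n m x mn x1.
rewrite Km0 expr0n/= mul0r addr0 => H.
by rewrite -ler_sqr ?nnegrE// !real_normK ?num_real.
Qed.

Lemma cheb_kernel_le_even {R : realType} (n m : nat) (x : R) :
  (m < n)%N -> ~~ odd (n - m) -> -1 < x < 1 ->
  `|cheb_kernel n m.+1 x| <= (Num.sqrt (n%:R ^+ 2 - m%:R ^+ 2))^-1 *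
    \prod_(0 <= j < m) (n - m + 2 * j + 1)%:R^-1.
Proof.
move=> mn nm x1; have n0 : (0 < n)%N by exact: leq_ltn_trans mn.
have := cheb_kernel_at0 n m n0 (ltnW mn) (R := R); rewrite (negbTE nm) => <-.
have := cheb_kernel_at0 n m.+1 n0 mn (R := R).
have nmE : (n - m = (n - m.+1).+1)%N by lia.
have -> : odd (n - m.+1) by move: nm; rewrite nmE /= negbK.
move=> Km0; have := sonine_bound n m x mn x1.
have D0 : 0 < n%:R ^+ 2 - m%:R ^+ 2 :> R by exact: subr_sqr_gt0.
rewrite Km0 expr0n/= add0r => H.
rewrite -ler_sqr ?nnegrE ?mulr_ge0 ?invr_ge0 ?sqrtr_ge0//.
by rewrite exprMn exprVn sqr_sqrtr ?(ltW D0)// !real_normK ?num_real// [leRHS]mulrC.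
Qed.

Lemma derivatives_upto_le {R : realType} (k m : nat) (u : R -> R) (v : nat -> R -> R) :
  (k <= m)%N -> derivatives_upto m u v -> derivatives_upto k u v.
Proof.
rewrite leq_eqVlt => /predU1P[->//|km] [h0 h1 h2]; split => //.
  by move=> j jk; apply: h1; exact: ltn_trans km.
case: k km => // k km _; apply: aeW => x x1; exact: h1.
Qed.

Theorem theorem1 (R : realType) (m : nat) (u : R -> R) (v : nat -> R -> R)
    (hv : derivatives_upto m u v)
    (hAC : forall k, (k < m)%N -> absolutely_continuous_on (-1) 1 (v k))
    (hBV : (total_variation_oo (-1)%R 1%R (v m) < +oo)%E)
    (n : nat) :
  [/\ (m + 1 <= n)%N -> odd (n - m) ->
        (`|chebyshev_coef u n|%:E <=
           (2 / pi * \prod_(0 <= j < m.+1) (n - m + 2 * j)%:R^-1)%:E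
           * total_variation_oo (-1)%R 1%R (v m))%E,
      (m + 1 <= n)%N -> ~~ odd (n - m) ->
        (`|chebyshev_coef u n|%:E <=
           (2 / (pi * Num.sqrt (n%:R ^+ 2 - m%:R ^+ 2))
            * \prod_(0 <= j < m) (n - m + 2 * j + 1)%:R^-1)%:E
           * total_variation_oo (-1)%R 1%R (v m))%E
    & (1 <= n <= m + 1)%N ->
        (`|chebyshev_coef u n|%:E <=
           (2 / (pi * (odd_double_factorial n)%:R))%:E
           * total_variation_oo (-1)%R 1%R (v n.-1))%E].
Proof.
split.
- rewrite addn1 => mn nm; apply: chebyshev_coef_le => // x x1.
  exact: cheb_kernel_le_odd.
- rewrite addn1 => mn nm; rewrite invfM mulrA -(mulrA (2 / pi)).
  by apply: chebyshev_coef_le => // x x1; exact: cheb_kernel_le_even.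
case: n => // k /=; rewrite addn1 ltnS => km.
have tv0 : (0 <= total_variation_oo (-1)%R 1%R (v k))%E.
  apply: le_trans (total_variation_le_oo _ _ 0 0 (v k) _ _ _) => //.
  by rewrite total_variation_ge0.
have ddfE : (odd_double_factorial k.+1)%:R^-1 =
    \prod_(0 <= j < k.+1) (k.+1 - k + 2 * j)%:R^-1 :> R.
  rewrite /odd_double_factorial natr_prod prodfV big_mkord.
  by congr (_^-1); apply: eq_bigr => j _; congr (_%:R); lia.
rewrite invfM mulrA.
(* If the variation is infinite, the right-hand side is +oo. *)
have [tvfin|] := boolP (total_variation_oo (-1)%R 1%R (v k) < +oo)%E; last first.
  rewrite -leNgt leye_eq => /eqP ->; rewrite gt0_muley ?leey//.
  rewrite lte_fin mulr_gt0 ?divr_gt0 ?pi_gt0// ddfE.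
  by rewrite big_mkord prodr_gt0// => j _; rewrite invr_gt0 ltr0n; lia.
apply: (chebyshev_coef_le k) => //.
- exact: derivatives_upto_le hv.
- by move=> j jk; apply: hAC; exact: leq_trans km.
- by move=> x x1; rewrite ddfE; apply: cheb_kernel_le_odd => //; rewrite subSnn.
Qed.
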